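(* Let $C \subseteq \mathbb{F}_q^n$ be a linear code with $C \neq 0$ and $C \neq \mathbb{F}_q^n$, of length $n$, minimum distance $d$ and dual minimum distance $d^\perp$. For $0 \le w \le n$ let $A_w$ be the number of codewords of weight $w$ in $C$ and let $a_w = A_w/\binom{n}{w}$. Then there exists a unique polynomial $g(w)$ of degree $n-d^\perp$ (with rational coefficients) such that $$g(w) = \left(a_w - (q-1)a_{w-1}\right)(-1)^{w-d} \quad \text{for } w = 1,2,\ldots,n.$$
   Context: $\mathbb{F}_q$ is the finite field with $q$ elements. A linear code of length $n$ over $\mathbb{F}_q$ is a linear subspace $C \subseteq \mathbb{F}_q^n$. The weight of a vector is its number of nonzero coordinates, and the minimum distance $d$ is the smallest weight of a nonzero codeword. The dual code $C^\perp$ is the orthogonal complement of $C$ with respect to the standard inner product on $\mathbb{F}_q^n$, and the dual minimum distance $d^\perp$ is the minimum distance of $C^\perp$. *)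

(* Defs.v *)
From mathcomp Require Import all_boot all_order all_algebra.

Set Implicit Arguments.
Unset Strict Implicit.
Unset Printing Implicit Defensive.

Import Order.TTheory GRing.Theory.
Local Open Scope ring_scope.

Section Codes.
Variables (F : finFieldType) (n : nat).
Implicit Types (C : {vspace 'rV[F]_n}) (c u v : 'rV[F]_n).

Definition wt c : nat := #|[set i | c 0 i != 0]|.

(* Every weight is at most n, so the default value n only matters for the
   zero code. *)
Definition min_dist C : nat := \big[minn/n]_(c in C | c != 0) wt c.

Definition dual_code C : {vspace 'rV[F]_n} :=
  (\bigcap_(u in C) lker (linfun (mulmxr u^T : 'rV[F]_n -> 'rV[F]_1)))%VS.

Definition weight_count C (w : nat) : nat := #|[set c in C | wt c == w]|.

Definition weight_ratio C (w : nat) : rat :=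
  (weight_count C w)%:R / 'C(n, w)%:R.

Lemma mem_dual_codeP C v :
  reflect (forall u, u \in C -> \sum_i v 0 i * u 0 i = 0) (v \in dual_code C).
Proof.
rewrite -[v \in _]memvE /dual_code.
apply: (iffP subv_bigcapP) => H u uC.
  have := H u uC; rewrite -memvE memv_ker lfunE /= => /eqP/matrixP/(_ 0 0).
  by rewrite !mxE => e; rewrite -[RHS]e; apply: eq_bigr => i _; rewrite mxE.
rewrite -memvE memv_ker lfunE /=; apply/eqP/matrixP => i j.
rewrite !ord1 !mxE -[RHS](H u uC).
by apply: eq_bigr => k _; rewrite mxE.
Qed.

Lemma min_distP C (d : nat) : C != 0%VS ->
  (min_dist C = d) <->
  ((exists c, [/\ c \in C, c != 0 & wt c = d]) /\
   (forall c, c \in C -> c != 0 -> (d <= wt c)%N)).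
Proof.
move=> C0.
have wt_le c : (wt c <= n)%N.
  by rewrite -[n in leqRHS]card_ord max_card.
have lb c : c \in C -> c != 0 -> (min_dist C <= wt c)%N.
  move=> cC cN0; rewrite /min_dist -minEnat -leEnat.
  by apply: bigmin_le_cond; rewrite cC.
have att : exists c, [/\ c \in C, c != 0 & wt c = min_dist C].
  pose c0 := vpick C.
  have c0P : (c0 \in C) && (c0 != 0) by rewrite memv_pick vpick0.
  case: (@arg_minnP _ c0 (fun c => (c \in C) && (c != 0)) wt c0P) => c /andP[cC cN0] cmin.
  exists c; split=> //; apply/eqP; rewrite eqn_leq lb // andbT.
  rewrite /min_dist; elim/big_ind: _ => // x y hx hy.
  by rewrite leq_min hx.
split=> [<- // | [[c [cC cN0 <-]] cmin]].
case: att => c' [c'C c'N0 e]; apply/eqP.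
by rewrite eqn_leq lb //= -e cmin.
Qed.

End Codes.

(* Main.v *)
(** Write [b_j(C) = \sum_w 'C(j, w) a_w] for the binomial moments of the weight
    ratios: [b_j(C)] is the average of [#|C_S|] over the [j]-subsets [S], where
    [C_S] is the subcode supported in [S].  Since [C_S] is the kernel of the
    projection of [C] to the complement of [S], a dimension count gives
    [b_j(C) = q ^ (k - n + j) * b_(n-j)(D)] with [D] the dual code and
    [k = \dim C].  Moreover [b_i(D) - 1] vanishes for [i < d_D], the minimum
    distance of [D], and is positive for [i = d_D].  Binomial inversion
    [(-1)^w a_w = \sum_j (-1)^j 'C(w, j) b_j] thus gives
    [(-1)^w a_w = q ^ (k - n) * (1 - q) ^ w + P(w)] with [P] of degree [n - d_D].
    The combination [a_w - (q - 1) a_(w-1)] cancels the exponential term and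
    leaves [P(w) + (q - 1) P(w - 1)], whose leading coefficient is [q] times that
    of [P].  Uniqueness holds because [n - d_D < n]. *)

Require Import Defs.
From mathcomp Require Import all_boot all_order all_algebra all_field.
From mathcomp Require Import zify ring.
Set Implicit Arguments.
Unset Strict Implicit.
Unset Printing Implicit Defensive.
Import GRing.Theory Num.Theory.
Local Open Scope ring_scope.

(** Both sides count pairs of disjoint subsets of sizes [w] and [t] in an [n]-set. *)
Lemma bin_mul_complement (n w t : nat) : (w <= n)%N -> (t <= n)%N ->
  ('C(n, w) * 'C(n - w, t) = 'C(n, t) * 'C(n - t, w))%N.
Proof.
move=> wn tn; have [le_tw | lt_tw] := leqP t (n - w); last first.
  by rewrite ['C(n - w, t)]bin_small // ['C(n - t, w)]bin_small ?muln0 //; lia.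
have le_wt : (w <= n - t)%N by lia.
apply/eqP; rewrite -(eqn_pmul2r (_ : 0 < w`! * t`! * (n - w - t)`!)%N).
  have := bin_fact wn; have := bin_fact le_tw.
  have := bin_fact tn; have := bin_fact le_wt.
  rewrite subnAC => e1 e2 e3 e4; apply/eqP; nia.
by rewrite !muln_gt0 !fact_gt0.
Qed.

(** * Coordinate projections and dimension counts *)

Section SupportMoments.

Variables (F : finFieldType) (n : nat).
Implicit Types (C : {vspace 'rV[F]_n}) (u v : 'rV[F]_n) (T : {set 'I_n}).

(** Coordinates outside [T] are zeroed rather than deleted, so a projected code keeps length [n] and
    its dual lives in the same space. *)
Definition coord_proj T : 'End('rV[F]_n) :=
  linfun (mulmxr (diag_mx (\row_i (i \in T)%:R))).

Lemma coord_projE T v i : coord_proj T v 0 i = v 0 i *+ (i \in T).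
Proof. by rewrite lfunE /= mul_mx_diag !mxE mulr_natr. Qed.

Lemma mem_lker_coord_proj T v :
  (v \in lker (coord_proj T)) = (T \subset ~: [set i | v 0 i != 0]).
Proof.
rewrite memv_ker; apply/eqP/subsetP => [p0 i iT | sT].
  by rewrite !inE negbK; move/rowP: p0 => /(_ i); rewrite coord_projE iT mxE mulr1n => ->.
apply/rowP=> i; rewrite coord_projE mxE; case: (boolP (i \in T)) => //.
by move=> /sT; rewrite !inE negbK => /eqP.
Qed.

(** Count elements: the kernel is in bijection with the functions supported on [~: T], and powers of
    [#|F|] determine their exponent. *)
Lemma dim_lker_coord_proj T : \dim (lker (coord_proj T)) = (n - #|T|)%N.
Proof.
apply: (@expnI #|F|); first exact: finNzRing_gt1.
rewrite -card_vspace.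
rewrite (_ : (n - #|T|)%N = #|~: T|); last by rewrite [RHS]cardsCs setCK card_ord.
rewrite -(card_pffun_on 0 (mem (~: T)) (predT : pred F)).
pose f (v : 'rV[F]_n) := [ffun i => v 0 i].
have fI : injective f.
  by move=> u v /ffunP e; apply/rowP=> i; have := e i; rewrite !ffunE.
rewrite -(card_imset _ fI); apply: eq_card => h.
apply/imsetP/pffun_onP => [[v vT ->] | [/subsetP sh _]].
  split=> //; apply/subsetP => i; rewrite !inE /= ffunE.
  apply: contraTN => iT; move: vT; rewrite mem_lker_coord_proj => /subsetP/(_ i iT).
  by rewrite !inE.
exists (\row_i h i); last by apply/ffunP => i; rewrite ffunE mxE.
rewrite mem_lker_coord_proj; apply/subsetP => i iT; rewrite !inE mxE negbK.
by apply: contraLR iT => hi; have := sh i hi; rewrite inE.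
Qed.

(** Rank-nullity for [v |-> v *m G^T], with [G] a generator matrix of [C]: the kernel is the dual
    code, and the map is onto because [G] has independent rows. *)
Lemma dim_dual_code C : (\dim (dual_code C) + \dim C)%N = n.
Proof.
pose G : 'M[F]_(\dim C, n) := \matrix_(i, j) (vbasis C)`_i 0 j.
have combG (y : 'rV_(\dim C)) : y *m G = \sum_i y 0 i *: (vbasis C)`_i.
  by apply/rowP=> j; rewrite mxE summxE; apply: eq_bigr => i _; rewrite !mxE.
have freeG : row_free G.
  apply: inj_row_free => y yG; apply/rowP=> i; rewrite mxE.
  have /freeP freeC := basis_free (vbasisP C).
  by apply: (freeC (y 0)); rewrite -combG yG.
pose f : 'Hom('rV[F]_n, 'rV[F]_(\dim C)) := linfun (mulmxr G^T).
have kerf : dual_code C = lker f.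
  apply/vspaceP=> v; rewrite memv_ker lfunE /=; apply/mem_dual_codeP/eqP => [vC | vG u uC].
    apply/rowP=> i; rewrite !mxE -[RHS](vC (vbasis C)`_i); last first.
      by rewrite vbasis_mem // mem_nth // size_tuple.
    by apply: eq_bigr => j _; rewrite !mxE.
  have: u = (\row_i coord (vbasis C) i u) *m G.
    by rewrite combG {1}(coord_vbasis uC); apply: eq_bigr => i _; rewrite mxE.
  move: (\row_i _) => y ->.
  have: v *m (y *m G)^T = 0 by rewrite trmx_mul mulmxA vG mul0mx.
  move/matrixP/(_ 0 0) => e; rewrite mxE [RHS]mxE in e.
  by rewrite -[RHS]e; apply: eq_bigr => j _; rewrite [in RHS]mxE.
have imf : limg f = fullv.
  apply/eqP; rewrite eqEsubv subvf; apply/subvP => y _.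
  have -> : y = f (y *m (pinvmx G)^T).
    by rewrite lfunE /= -mulmxA -trmx_mul mulmxVp // trmx1 mulmx1.
  by rewrite memv_img ?memvf.
have := limg_ker_dim f fullv; rewrite capfv -kerf imf !dimvf.
by rewrite /dim /= !mul1n.
Qed.

(* [v] is orthogonal to the projection of [C] iff its own projection is
   orthogonal to [C], so projecting the dual of that projection gives the words
   of the dual code supported in [T]. *)
Lemma dim_cap_lker_coord_proj C T :
  (\dim (C :&: lker (coord_proj T)) + #|T|)%N =
  (\dim C + \dim (dual_code C :&: lker (coord_proj (~: T))))%N.
Proof.
pose p := coord_proj T.
have sum_proj u v : \sum_i v 0 i * p u 0 i = \sum_i p v 0 i * u 0 i.
  by apply: eq_bigr => i _; rewrite !coord_projE mulrnAl mulrnAr.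
have mem_dual v : (v \in dual_code (p @: C)) = (p v \in dual_code C).
  apply/mem_dual_codeP/mem_dual_codeP => h u.
    by move=> uC; rewrite -sum_proj h // memv_img.
  by case/memv_imgP=> c cC ->; rewrite sum_proj h.
have ker_dual : (dual_code (p @: C) :&: lker p)%VS = lker p.
  apply/capv_idPr/subvP => v; rewrite mem_dual memv_ker => /eqP ->.
  exact: mem0v.
have im_dual : (p @: dual_code (p @: C))%VS =
               (dual_code C :&: lker (coord_proj (~: T)))%VS.
  apply/vspaceP => v; rewrite memv_cap; apply/memv_imgP/andP => [[u] | [vC vT]].
    rewrite mem_dual => uC ->; split=> //.
    rewrite mem_lker_coord_proj setCS; apply/subsetP => i; rewrite !inE coord_projE.
    by case: (i \in T) => //; rewrite mulr0n eqxx.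
  have pv : p v = v.
    apply/rowP=> i; rewrite coord_projE; case: (boolP (i \in T)) => // iT.
    move: vT; rewrite mem_lker_coord_proj setCS => /subsetP/(_ i).
    by rewrite inE (negPf iT); case: eqP => [-> // | _ /(_ isT)].
  by exists v; rewrite ?mem_dual pv.
(* Here [c] and [d] are the dimensions of [p @: C] and of its dual, [n - t] that of [lker p], while
   [b] and [a] are those of the two intersections in the goal. *)
have arith (a b c d k t : nat) : (t <= n)%N -> (d + c)%N = n ->
    (n - t + a)%N = d -> (b + c)%N = k -> (b + t)%N = (k + a)%N by lia.
apply: arith (dim_dual_code (p @: C)) _ (limg_ker_dim p C).
  by rewrite -[n in leqRHS]card_ord max_card.
by rewrite -(limg_ker_dim p (dual_code _)) ker_dual im_dual dim_lker_coord_proj.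
Qed.

(** * Binomial moments, their duality and their inversion *)

Definition weight_moment C j : rat :=
  \sum_(w < n.+1) 'C(j, w)%:R * weight_ratio C w.

Lemma wt_le v : (wt v <= n)%N.
Proof. by rewrite -[n in leqRHS]card_ord max_card. Qed.

(** Double counting: a word lies in the kernel for [T] exactly when [T] avoids its support. *)
Lemma sum_card_cap_lker_coord_proj C (t : nat) :
  (\sum_(T : {set 'I_n} | #|T| == t) #|(C :&: lker (coord_proj T))%VS| =
   \sum_(c in C) 'C(n - wt c, t))%N.
Proof.
transitivity (\sum_(T : {set 'I_n} | #|T| == t)
    \sum_(c in C) if c \in lker (coord_proj T) then 1 else 0)%N.
  apply: eq_bigr => T _; rewrite -big_mkcondr -sum1_card.
  by apply: eq_bigl => c; rewrite memv_cap.
rewrite exchange_big /=; apply: eq_bigr => c _.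
rewrite -big_mkcondr sum1dep_card -[X in 'C(X, _)](_ : #|~: [set i | c 0 i != 0]| = _).
  rewrite -cards_draws; apply: eq_card => T; rewrite !inE.
  by rewrite mem_lker_coord_proj andbC.
by rewrite cardsCs setCK card_ord.
Qed.

Lemma sum_bin_wt C t : (t <= n)%N ->
  (\sum_(c in C) 'C(n - wt c, t))%:R = 'C(n, t)%:R * weight_moment C (n - t).
Proof.
move=> tn.
transitivity (\sum_(w < n.+1) (weight_count C w * 'C(n - w, t))%:R : rat).
  rewrite -natr_sum; congr _%:R.
  rewrite (partition_big (fun c => inord (wt c) : 'I_n.+1) predT) //=.
  apply: eq_bigr => w _; rewrite /weight_count -sum1_card big_distrl /=.
  have e (c : 'rV[F]_n) : (inord (wt c) == w) = (wt c == w).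
    by rewrite -val_eqE /= inordK // ltnS wt_le.
  apply: eq_big => [c | c /andP[_]]; first by rewrite inE e.
  by rewrite e mul1n => /eqP ->.
rewrite mulr_sumr; apply: eq_bigr => w _; rewrite /weight_ratio.
have wn : (w <= n)%N by rewrite -ltnS.
have nz : 'C(n, w)%:R != 0 :> rat by rewrite pnatr_eq0 -lt0n bin_gt0.
rewrite mulrA -natrM -bin_mul_complement // !natrM.
by field.
Qed.

(** The MacWilliams identities in moment form: sum [dim_cap_lker_coord_proj], turned into
    cardinalities, over all [T] of size [t]; the dual side runs over the complements. *)
Lemma weight_moment_dual C t : (t <= n)%N ->
  #|F|%:R ^+ t * weight_moment C (n - t) =
  #|F|%:R ^+ \dim C * weight_moment (dual_code C) t.
Proof.
move=> tn.
have nz : 'C(n, t)%:R != 0 :> rat by rewrite pnatr_eq0 -lt0n bin_gt0.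
apply: (mulfI nz); rewrite mulrCA -sum_bin_wt // [RHS]mulrCA.
have := sum_bin_wt (dual_code C) (leq_subr t n).
rewrite bin_sub // subKn // => <-.
rewrite -!natrX -!natrM -!sum_card_cap_lker_coord_proj; congr _%:R.
rewrite !big_distrr /= (reindex_inj (can_inj (@setCK _))) /=.
have cardC T : (#|~: T| + #|T|)%N = n by rewrite addnC cardsC card_ord.
apply: eq_big => [T | T /eqP Tt].
  have e (a b : nat) : (a + b)%N = n -> (a == t) = (b == n - t)%N by lia.
  exact: e (cardC T).
rewrite !card_vspace -!expnD -{1}Tt addnC dim_cap_lker_coord_proj setCK.
by [].
Qed.

Lemma weight_ratio_inversion C w : (w <= n)%N ->
  (-1) ^+ w * weight_ratio C w =
  \sum_(j < n.+1) (-1) ^+ j * 'C(w, j)%:R * weight_moment C j.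
Proof.
move=> wn; pose L (p : {poly rat}) := \sum_(i < n.+1) p`_i * weight_ratio C i.
have LX j : L (('X + 1) ^+ j) = weight_moment C j.
  apply: eq_bigr => i _; rewrite exprD1n coef_sum; congr (_ * _).
  have [ij | ji] := ltnP i j.+1.
    rewrite (bigD1 (Ordinal ij)) //= coefMn coefXn eqxx big1 ?addr0 // => k.
    by rewrite -val_eqE /= eq_sym coefMn coefXn => /negPf ->; rewrite mul0rn.
  rewrite bin_small // big1 // => k _; rewrite coefMn coefXn.
  by case: eqP => [e|]; rewrite ?mul0rn //; have := ltn_ord k; lia.
have L_sum (I : finType) (c : I -> rat) (p : I -> {poly rat}) :
    L (\sum_i c i *: p i) = \sum_i c i * L (p i).
  rewrite /L; under eq_bigr => k _ do rewrite coef_sum big_distrl /=.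
  rewrite exchange_big /=; apply: eq_bigr => i _; rewrite mulr_sumr.
  by apply: eq_bigr => k _; rewrite coefZ -mulrA.
(* [L] is the linear functional ['X^i |-> a_i]; the inversion is the expansion
   of [(- 'X) ^+ w] in powers of ['X + 1]. *)
transitivity (L ((1 - ('X + 1)) ^+ w)).
  rewrite opprD addrCA subrr addr0 -scaleN1r exprZn /L.
  rewrite (bigD1 (Ordinal (wn : w < n.+1)%N)) //= coefZ coefXn eqxx mulr1.
  rewrite big1 ?addr0 // => k; rewrite -val_eqE /= coefZ coefXn => /negPf ->.
  by rewrite mulr0 mul0r.
under [RHS]eq_bigr => j _ do rewrite -LX.
rewrite -L_sum exprBn; congr L.
rewrite (big_ord_widen n.+1 (fun j =>
  (-1) ^+ j * 1 ^+ (w - j) * ('X + 1) ^+ j *+ 'C(w, j) : {poly rat})) //.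
rewrite big_mkcond; apply: eq_bigr => j _.
rewrite expr1n mulr1 ltnS; case: leqP => [_ | wj]; last by rewrite bin_small // mulr0 scale0r.
rewrite -scalerA scaler_nat -scalerMnr; congr (_ *+ _).
by rewrite -signr_odd mulr_sign -[in RHS]signr_odd scaler_sign.
Qed.

(** * Weight ratios and moments up to the minimum distance *)

Lemma weight_ratio0 C : weight_ratio C 0 = 1.
Proof.
rewrite /weight_ratio bin0 divr1 /weight_count (_ : [set _ in _ | _] = [set 0]) ?cards1 //.
apply/setP => c; rewrite !inE cards_eq0.
apply/andP/eqP => [[_ /eqP/setP c0] | ->].
  by apply/rowP=> i; have := c0 i; rewrite !inE mxE => /negbFE/eqP.
by split; [exact: mem0v | apply/eqP/setP => i; rewrite !inE mxE eqxx].
Qed.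

Lemma weight_ratio_eq0 C w :
  (0 < w < min_dist C)%N -> C != 0%VS -> weight_ratio C w = 0.
Proof.
move=> /andP[w0 wd] /(min_distP (min_dist C))[/(_ erefl)[_ dmin] _].
rewrite /weight_ratio /weight_count (_ : [set _ in _ | _] = set0) ?cards0 ?mul0r //.
apply/setP => c; rewrite !inE; apply/andP => -[cC /eqP cw].
have [c0 | c0] := eqVneq c 0; last by have := dmin c cC c0; lia.
by move: w0; rewrite -cw c0 /wt card_gt0 => /set0Pn[i]; rewrite inE mxE eqxx.
Qed.

Lemma weight_ratio_min_dist C : C != 0%VS -> 0 < weight_ratio C (min_dist C).
Proof.
move=> /(min_distP (min_dist C))[/(_ erefl)[[c [cC c0 cd]] _] _].
rewrite /weight_ratio divr_gt0 ?ltr0n ?bin_gt0 -?cd ?wt_le // card_gt0.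
by apply/set0Pn; exists c; rewrite inE cC eqxx.
Qed.

Lemma min_dist_bounds C : C != 0%VS -> (0 < min_dist C <= n)%N.
Proof.
move=> /(min_distP (min_dist C))[/(_ erefl)[[c [_ c0 <-]] _] _].
rewrite wt_le andbT card_gt0; apply: contraNneq c0 => /setP c0; apply/eqP.
by apply/rowP=> i; have := c0 i; rewrite !inE mxE => /negbFE/eqP.
Qed.

Lemma weight_moment_lt_min_dist C j : C != 0%VS -> (j < min_dist C)%N ->
  weight_moment C j = 1.
Proof.
move=> C0 jd; rewrite /weight_moment big_ord_recl bin0 weight_ratio0 mulr1.
rewrite big1 ?addr0 // => w _; have [wd | dw] := ltnP (lift ord0 w) (min_dist C).
  by rewrite weight_ratio_eq0 ?mulr0.
by rewrite bin_small ?mul0r // (leq_trans jd).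
Qed.

Lemma weight_moment_min_dist C : C != 0%VS ->
  weight_moment C (min_dist C) = 1 + weight_ratio C (min_dist C).
Proof.
move=> C0; have /andP[d0 dn] := min_dist_bounds C0.
rewrite /weight_moment (bigD1 ord0) //= bin0 weight_ratio0 mulr1; congr (1 + _).
rewrite (bigD1 (Ordinal (dn : min_dist C < n.+1)%N)) /=; last by rewrite -val_eqE /= -lt0n.
rewrite binn mul1r big1 ?addr0 // => w /andP[]; rewrite -!val_eqE /= => w0 wd.
have [wltd | dlew] := ltnP w (min_dist C).
  by rewrite weight_ratio_eq0 ?mulr0 // lt0n w0.
by rewrite bin_small ?mul0r // ltn_neqAle eq_sym wd.
Qed.

Lemma dual_code_neq0 C : C != fullv -> dual_code C != 0%VS.
Proof.
apply: contraNneq => D0; have := dim_dual_code C; rewrite D0 dimv0 add0n => dC.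
by rewrite eqEdim subvf dimvf /dim /= mul1n dC leqnn.
Qed.

End SupportMoments.

(** * Binomial coefficients as polynomials, and degree computations *)

Definition bin_poly j : {poly rat} :=
  (j`!%:R)^-1 *: \prod_(i < j) ('X - i%:R%:P).

Lemma bin_polyE j w : (bin_poly j).[w%:R] = 'C(w, j)%:R.
Proof.
have fj : j`!%:R != 0 :> rat by rewrite pnatr_eq0 -lt0n fact_gt0.
apply: (mulfI fj); rewrite hornerZ mulVKf // mulrC -natrM bin_ffact.
elim: j {fj} => [|j IHj]; first by rewrite big_ord0 hornerC.
rewrite big_ord_recr hornerM IHj ffactnSr hornerXsubC natrM /=.
have [jw | wj] := leqP j w; first by rewrite natrB.
by rewrite ffact_small ?mul0r.
Qed.

Lemma size_bin_poly j : size (bin_poly j) = j.+1.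
Proof.
rewrite size_scale ?invr_eq0 ?pnatr_eq0 -?lt0n ?fact_gt0 //.
by rewrite size_prod_XsubC /index_enum -enumT size_enum_ord.
Qed.

Lemma size_sum_bin_poly m (c : nat -> rat) :
  c m != 0 -> size (\sum_(j < m.+1) c j *: bin_poly j) = m.+1.
Proof.
move=> cm; rewrite big_ord_recr /= addrC size_polyDl size_scale ?size_bin_poly //.
rewrite ltnS; apply: (leq_trans (size_sum _ _ _)); apply/bigmax_leqP => i _.
by apply: (leq_trans (size_scale_leq _ _)); rewrite size_bin_poly.
Qed.

(** The shift preserves degree and leading coefficient, so the sum has leading coefficient [1 + a]
    times that of [p]. *)
Lemma size_add_scale_shift (p : {poly rat}) (a : rat) : 1 + a != 0 ->
  size (p + a *: (p \Po ('X - 1))) = size p.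
Proof.
move=> a1; have [-> | p0] := eqVneq p 0; first by rewrite comp_poly0 scaler0 addr0.
have s2 : size ('X - 1 : {poly rat}) = 2 by rewrite -polyC1 size_XsubC.
have sz := size_comp_poly2 p s2.
apply/eqP; rewrite eqn_leq; apply/andP; split.
  apply: (leq_trans (size_polyD _ _)); rewrite geq_max leqnn.
  by rewrite -[leqRHS]sz size_scale_leq.
rewrite polySpred // ltnNge; apply/negP => /leq_sizeP/(_ _ (leqnn _)).
have := lead_coef_comp p (_ : (1 < size ('X - 1 : {poly rat})%R)%N).
rewrite s2 -polyC1 lead_coefXsubC expr1n mulr1 => /(_ isT).
rewrite !lead_coefE sz coefD coefZ => ->; apply/eqP.
by rewrite -{1}[_`__]mul1r -mulrDl mulf_neq0 // -lead_coefE lead_coef_eq0.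
Qed.

Theorem lemma1 (F : finFieldType) (n : nat) (C : {vspace 'rV[F]_n})
    (C_neq0 : C != 0%VS) (C_neqT : C != fullv) :
  exists! g : {poly rat},
    size g = (n - min_dist (dual_code C)).+1 /\
    forall w : nat, (1 <= w <= n)%N ->
      g.[w%:R] =
        (weight_ratio C w - (#|F|%:R - 1) * weight_ratio C (w - 1)%N)
        * (-1) ^ (w%:Z - (min_dist C)%:Z).
Proof.
set D := dual_code C; set q : rat := #|F|%:R.
have D0 : D != 0%VS by exact: dual_code_neq0.
have /andP[d_gt0 d_le] := min_dist_bounds D0.
have q0 : q != 0 by rewrite pnatr_eq0 -lt0n; apply/card_gt0P; exists 0.
have sgn0 : (-1 : rat) != 0 by rewrite oppr_eq0 oner_eq0.
(* [r] is [q ^ (k - n)] with [k = \dim C], written as a quotient because the exponent is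
   negative. *)
pose m := (n - min_dist D)%N; pose r := q ^+ \dim C / q ^+ n.
have r0 : r != 0 by rewrite mulf_neq0 ?invr_eq0 ?expf_neq0.
(* By [momentE] below, [c j] is [(-1) ^+ j * (weight_moment C j - r * q ^+ j)]; it vanishes for
   [m < j <= n], where the dual moment is 1. *)
pose c j := (-1) ^+ j * r * q ^+ j * (weight_moment D (n - j) - 1).
pose P := \sum_(j < m.+1) c j *: bin_poly j.
have momentE j : (j <= n)%N -> weight_moment C j = r * q ^+ j * weight_moment D (n - j).
  move=> jn; have := weight_moment_dual C (leq_subr j n); rewrite subKn //.
  have qn : q ^+ n = q ^+ j * q ^+ (n - j) by rewrite -exprD subnKC.
  rewrite /r qn => e; apply: (mulfI (expf_neq0 (n - j) q0)); rewrite e -/D -/q.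
  by field; rewrite !expf_neq0.
have PE w : (w <= n)%N ->
    P.[w%:R] = (-1) ^+ w * weight_ratio C w - r * (1 - q) ^+ w.
  move=> wn; have mn : (m < n.+1)%N by rewrite ltnS leq_subr.
  rewrite horner_sum (big_ord_widen n.+1 (fun j => (c j *: bin_poly j).[w%:R])) //.
  have -> : (1 - q) ^+ w = \sum_(j < n.+1) (-1) ^+ j * q ^+ j * 'C(w, j)%:R.
    rewrite exprBn (big_ord_widen n.+1 (fun j =>
      (-1) ^+ j * 1 ^+ (w - j) * q ^+ j *+ 'C(w, j))) //.
    rewrite big_mkcond; apply: eq_bigr => j _; rewrite expr1n mulr1 ltnS mulr_natr.
    by case: leqP => // wj; rewrite bin_small.
  rewrite weight_ratio_inversion // mulr_sumr -sumrB big_mkcond; apply: eq_bigr => j _.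
  have jn : (j <= n)%N by rewrite -ltnS.
  rewrite hornerZ bin_polyE momentE // /c; case: ifP => [_ | /negbT mj]; first by ring.
  rewrite weight_moment_lt_min_dist //; first by ring.
  by move: mj; rewrite /m; lia.
(* The top coefficient [c m] is a nonzero multiple of the weight ratio of [D] at its minimum
   distance, which is positive. *)
have size_P : size P = m.+1.
  apply: size_sum_bin_poly; rewrite /c subKn // weight_moment_min_dist // addrC addKr.
  rewrite mulf_neq0 ?(lt0r_neq0 (weight_ratio_min_dist D0)) //.
  by rewrite mulf_neq0 ?expf_neq0 // mulf_neq0 ?expf_neq0.
(* For [w >= 1], [(1 - q) ^+ w + (q - 1) * (1 - q) ^+ (w - 1) = 0], so this combination removes the
   exponential term of [PE]. *)
pose g := (-1) ^+ min_dist C *: (P + (q - 1) *: (P \Po ('X - 1))).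
have size_g : size g = m.+1.
  by rewrite size_scale ?expf_neq0 // size_add_scale_shift ?size_P // addrC subrK.
have gE w : (1 <= w <= n)%N -> g.[w%:R] =
    (weight_ratio C w - (q - 1) * weight_ratio C (w - 1)%N)
      * (-1) ^ (w%:Z - (min_dist C)%:Z).
  case: w => [//|u] /andP[_ un]; rewrite subn1 /= expfzDr // -exprnN -exprVn invrN1.
  rewrite hornerZ hornerD hornerZ horner_comp PE // hornerD hornerX hornerN hornerC.
  rewrite -[in P.[_]]natr1 addrK PE ?(ltnW un) // -exprnP !exprS.
  have arith (e s x a b t y : rat) :
      e * (- 1 * s * a - t * ((1 - x) * y) + (x - 1) * (s * b - t * y)) =
      (a - (x - 1) * b) * (- 1 * s * e) by ring.
  exact: arith.
exists g; split=> // h [size_h hE]; apply/eqP; rewrite -subr_eq0; apply/eqP.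
(* The difference has the [n] roots [1, ..., n], while its size is at most [m.+1 <= n] because
   [min_dist D] is positive. *)
apply: (@roots_geq_poly_eq0 _ _ [seq w%:R | w <- iota 1 n]).
- apply/allP => _ /mapP[w wI ->]; rewrite rootE hornerD hornerN.
  have wn : (1 <= w <= n)%N by move: wI; rewrite mem_iota add1n ltnS.
  by rewrite gE // hE // subrr.
- by rewrite map_inj_uniq ?iota_uniq // => i j /eqP; rewrite eqr_nat => /eqP.
rewrite size_map size_iota; apply: (leq_trans (size_polyD _ _)).
by rewrite size_polyN size_g size_h maxnn -/m /m; lia.
Qed.
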